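(* Let $1\le q<s\le n$ and $1\le t<r\le m$ be integers. Then: (1) $\operatorname{depth} S/(I_s+J_r)=s+r-2$; (2) $\operatorname{depth} S/(I_qJ_r+I_s)=q+r-1$; (3) $\operatorname{depth} S/(I_qJ_r+I_sJ_t)=\min(q+r,\,s+t)-1$.
   Context: Let $K$ be a field, $n,m\ge 0$ integers, and $S=K[x_1,\dots,x_n,y_1,\dots,y_m]$ the polynomial ring in $n+m$ variables with its standard grading. For $0\le k\le n$, $I_k\subseteq S$ is the ideal generated by all square-free monomials of degree $k$ in the variables $x_1,\dots,x_n$; for $0\le l\le m$, $J_l\subseteq S$ is the ideal generated by all square-free monomials of degree $l$ in the variables $y_1,\dots,y_m$. Depth of a finitely generated graded $S$-module is taken with respect to the graded maximal ideal $(x_1,\dots,x_n,y_1,\dots,y_m)$. *)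

(* Defs.v *)
From HB Require Import structures.
From mathcomp Require Import all_boot all_order all_algebra.
From mathcomp.multinomials Require Import mpoly.

Set Implicit Arguments.
Unset Strict Implicit.
Unset Printing Implicit Defensive.

Import GRing.Theory.
Local Open Scope ring_scope.

Section Ideals.
Variable R : comNzRingType.
Implicit Types (G I J : R -> Prop) (f : R) (fs : seq R).

Definition ideal_gen G f : Prop :=
  exists2 cg : seq (R * R),
    (forall p, p \in cg -> G p.2) & f = \sum_(p <- cg) p.1 * p.2.

Definition ideal_add I J f : Prop :=
  exists a b : R, [/\ I a, J b & f = a + b].

Definition ideal_mul I J : R -> Prop :=
  ideal_gen (fun f => exists a b : R, [/\ I a, J b & f = a * b]).

(* [regular_on_quot I fs]: fs is a regular sequence on the R-module R/I, where
   residue classes are handled through representatives. Each element is a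
   nonzerodivisor on R/(I + the preceding elements), and, when fs is exhausted,
   the final quotient R/(I + (fs)) must be nonzero. *)
Fixpoint regular_on_quot I fs : Prop :=
  if fs is f :: fs' then
    (forall g : R, I (f * g) -> I g) /\
    regular_on_quot (ideal_add I (ideal_gen (fun h => h = f))) fs'
  else ~ I 1.

(* [depth_quot M I d]: the maximal length of a regular sequence on R/I
   consisting of elements of M is d. *)
Definition depth_quot (M I : R -> Prop) (d : nat) : Prop :=
  (exists fs : seq R,
     [/\ forall f, f \in fs -> M f, regular_on_quot I fs & size fs = d]) /\
  (forall fs : seq R,
     (forall f, f \in fs -> M f) -> regular_on_quot I fs -> (size fs <= d)%N).

End Ideals.

Section SquareFree.
Variables (K : fieldType) (n m : nat).

(* In K[x_1..x_n, y_1..y_m], the first n variables are the x's and the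
   remaining m are the y's. *)
Definition xvar (i : 'I_n) : {mpoly K[n + m]} := 'X_(lshift m i).
Definition yvar (j : 'I_m) : {mpoly K[n + m]} := 'X_(rshift n j).

Definition sqfree_x (k : nat) : {mpoly K[n + m]} -> Prop :=
  ideal_gen (fun f => exists2 A : {set 'I_n}, #|A| = k & f = \prod_(i in A) xvar i).

Definition sqfree_y (l : nat) : {mpoly K[n + m]} -> Prop :=
  ideal_gen (fun f => exists2 B : {set 'I_m}, #|B| = l & f = \prod_(j in B) yvar j).

Definition graded_max : {mpoly K[n + m]} -> Prop :=
  ideal_gen (fun f => exists i : 'I_(n + m), f = 'X_i).

Definition depth_S_mod (I : {mpoly K[n + m]} -> Prop) (d : nat) : Prop :=
  depth_quot graded_max I d.

End SquareFree.

Arguments xvar K n m i : clear implicits.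
Arguments yvar K n m j : clear implicits.
Arguments sqfree_x K n m k _ : clear implicits.
Arguments sqfree_y K n m l _ : clear implicits.
Arguments graded_max K n m _ : clear implicits.

(* Main.v *)
From Stdlib Require Import Classical_Prop FunctionalExtensionality PropExtensionality.
Require Import Defs.
From mathcomp Require Import all_boot all_order all_algebra ring zify.
From mathcomp.multinomials Require Import mpoly.

Set Implicit Arguments.
Unset Strict Implicit.
Unset Printing Implicit Defensive.

Import GRing.Theory.
Local Open Scope ring_scope.

(** Every ideal involved is the Stanley-Reisner ideal of a simplicial complex on
the variables. Cutting out the variables one at a time shows that the elementary
symmetric polynomials [e_1, ..., e_d] of all variables are regular modulo an ideal
generated by [N - d] variables; the exact sequences
[0 -> S/(I : x) -> S/I -> S/(I + x) -> 0] carry this over to [S/(I_a + J_b)] with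
[d = a + b - 2]. There the quotient by [e_1, ..., e_d] is Artinian by Vieta, so it
has a socle, and a weakly regular sequence followed by a socle is at least as long
as any other regular sequence.

The other two ideals are the intersections [I_q & (I_s + J_r)] and
[I_q & J_t & (I_s + J_r)]. A Mayer-Vietoris step expresses the depth of
[S/(A & B)] as one more than that of [S/(A + B)] when the latter is small; in the
triple intersection one splits off [I_q] or [J_t] according to the minimum of
[q + r] and [s + t]. *)

Lemma predP (T : Type) (A B : T -> Prop) : (forall x, A x <-> B x) -> A = B.
Proof.
by move=> eAB; apply: functional_extensionality => x; apply: propositional_extensionality.
Qed.

(** * Weakly regular sequences and socles over a commutative ring *)

Section WeaklyRegular.
Variable R : comNzRingType.
Implicit Types (I J A B M : R -> Prop) (f g h u : R) (fs gs : seq R).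

Definition ideal I :=
  [/\ I 0, forall a b, I a -> I b -> I (a + b) & forall c a, I a -> I (c * a)].

(** The ideal [I + (f)], with a single coefficient, so that identities in the ring supply witnesses
    directly. *)
Definition adj I f : R -> Prop := fun h => exists c, I (h - c * f).
Definition adjs I fs : R -> Prop := foldl adj I fs.
Definition nzd I f := forall g, I (f * g) -> I g.

(** The final quotient may vanish, because unit ideals arise as colon ideals in the
    deletion-contraction argument. *)
Fixpoint wreg I fs : Prop :=
  if fs is f :: fs' then nzd I f /\ wreg (adj I f) fs' else True.

Definition socle M I u := ~ I u /\ forall g, M g -> I (g * u).

Definition sumI A B : R -> Prop := fun h => exists2 a, A a & B (h - a).
Definition capI A B : R -> Prop := fun h => A h /\ B h.

Section IdealTheory.
Variable I : R -> Prop.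
Hypothesis idI : ideal I.

Lemma id0 : I 0. Proof. by case: idI. Qed.
Lemma idD a b : I a -> I b -> I (a + b). Proof. by case: idI => _ + _; apply. Qed.
Lemma idMl c a : I a -> I (c * a). Proof. by case: idI => _ _; apply. Qed.
Lemma idMr c a : I a -> I (a * c). Proof. by rewrite mulrC; apply: idMl. Qed.
Lemma idN a : I a -> I (- a). Proof. by rewrite -mulN1r; apply: idMl. Qed.
Lemma idB a b : I a -> I b -> I (a - b).
Proof. by move=> Ia Ib; apply: idD => //; apply: idN. Qed.
Lemma idDr a b : I a -> I (a + b) -> I b.
Proof. by move=> Ia /idB/(_ Ia); rewrite addrC addKr. Qed.
Lemma id_sum (T : Type) (r : seq T) (P : pred T) (F : T -> R) :
  (forall i, P i -> I (F i)) -> I (\sum_(i <- r | P i) F i).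
Proof. by move=> IF; apply: (big_ind I) => //; [exact: id0|exact: idD]. Qed.

Lemma sub_adj f h : I h -> adj I f h.
Proof. by exists 0; rewrite mul0r subr0. Qed.

Lemma mem_adj f : adj I f f.
Proof. by exists 1; rewrite mul1r subrr; apply: id0. Qed.

Lemma ideal_adj f : ideal (adj I f).
Proof.
split; first by apply: sub_adj; apply: id0.
- move=> a b [c Ic] [d Id]; exists (c + d).
  by have := idD Ic Id; congr (I _); ring.
move=> c a [d Id]; exists (c * d).
by have := idMl c Id; congr (I _); ring.
Qed.

End IdealTheory.

Lemma ideal_adjs I fs : ideal I -> ideal (adjs I fs).
Proof. by by elim: fs I => //= f fs IH I idI; apply: IH; apply: ideal_adj. Qed.

Lemma sub_adjs I fs h : ideal I -> I h -> adjs I fs h.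
Proof.
elim: fs I => //= f fs IH I idI Ih; apply: IH; first exact: ideal_adj.
exact: sub_adj.
Qed.

Lemma mem_adjs I fs f : ideal I -> f \in fs -> adjs I fs f.
Proof.
elim: fs I => //= g fs IH I idI; rewrite inE => /orP[/eqP->|]; last first.
  by apply: IH; apply: ideal_adj.
by apply: sub_adjs; [apply: ideal_adj|apply: mem_adj].
Qed.

Lemma adjs_cat I fs gs : adjs I (fs ++ gs) = adjs (adjs I fs) gs.
Proof. exact: foldl_cat. Qed.

Lemma adjs_rcons I fs f : adjs I (rcons fs f) = adj (adjs I fs) f.
Proof. by rewrite -cats1 adjs_cat. Qed.

Lemma wreg_cat I fs gs : wreg I (fs ++ gs) <-> wreg I fs /\ wreg (adjs I fs) gs.
Proof.
elim: fs I => [|f fs IH] I /=; first by split=> // -[].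
by rewrite IH; split=> [[? []]|[[]]].
Qed.

Lemma wreg_rcons I fs f : wreg I (rcons fs f) <-> wreg I fs /\ nzd (adjs I fs) f.
Proof. by rewrite -cats1 wreg_cat /=; split=> [[? []]|[]]. Qed.

Lemma adjC I f g : adj (adj I f) g = adj (adj I g) f.
Proof.
by apply: predP => h; split=> -[c [d Id]]; exists d; exists c; move: Id; congr (I _); ring.
Qed.

Lemma adjs_adjC I fs h : adjs (adj I h) fs = adj (adjs I fs) h.
Proof. by elim: fs I => //= f fs IH I; rewrite adjC IH. Qed.

(** If [f * g = c * h] modulo [I], then [c = d * f] because [h] is regular modulo [I + (f)], and [f]
    cancels from [f * (g - d * h)]. *)
Lemma nzd_swap I f h :
  ideal I -> nzd I f -> nzd I h -> nzd (adj I f) h -> nzd (adj I h) f.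
Proof.
move=> idI nf nh nfh g [c Ic].
have /nfh[d Id] : adj I f (h * c).
  by exists g; have := idN idI Ic; congr (I _); ring.
exists d; apply: nf.
have := idD idI Ic (idMl idI h Id); congr (I _); ring.
Qed.

(** An element regular modulo every prefix moves to the front, past one entry at a time by
    [nzd_swap]. *)
Lemma wreg_swap I fs h : ideal I -> wreg I fs ->
  (forall s1 s2, fs = s1 ++ s2 -> nzd (adjs I s1) h) -> wreg (adj I h) fs.
Proof.
elim: fs I => //= f fs IH I idI [nf wf] nh; split.
  by apply: nzd_swap => //; [apply: (nh [::] (f :: fs))|apply: (nh [:: f] fs)].
rewrite adjC; apply: IH => //; first exact: ideal_adj.
by move=> s1 s2 e; apply: (nh (f :: s1) s2); rewrite e.
Qed.

(* Both socles are [Ext^1(R/M, R/I)]. *)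
Lemma socle_exchange M I f h u : ideal I -> M h -> nzd I f -> nzd I h ->
  socle M (adj I f) u -> exists v, socle M (adj I h) v.
Proof.
move=> idI Mh nf nh [nu su].
have [v Iv] := su _ Mh; exists v; split.
  case=> v' Iv'; apply: nu; exists v'; apply: nh.
  by have := idD idI Iv (idMr idI f Iv'); congr (I _); ring.
move=> g Mg; have [w Iw] := su _ Mg; exists w; apply: nf.
by have := idB idI (idMl idI h Iw) (idMl idI g Iv); congr (I _); ring.
Qed.

(* The end terms of 0 -> R/(I : g) -> R/I -> R/(I + g) -> 0 control the middle one. *)
Lemma wreg_colon I g fs : ideal I ->
  wreg (fun h => I (g * h)) fs -> wreg (adj I g) fs -> wreg I fs.
Proof.
elim: fs I => //= f fs IH I idI [ncf wc] [naf wa].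
have colonP : adj (fun h => I (g * h)) f = fun h => adj I f (g * h).
  apply: predP => h; split=> [[c Ic]|[c Ic]].
    by exists (g * c); move: Ic; congr (I _); ring.
  have /naf[d Id] : adj I g (f * c).
    by exists h; have := idN idI Ic; congr (I _); ring.
  by exists d; have := idD idI Ic (idMl idI f Id); congr (I _); ring.
split.
  move=> p Ip; have [c Ic] := naf p (sub_adj g Ip).
  have /ncf Ic2 : I (g * (f * c)).
    by have := idB idI Ip (idMl idI f Ic); congr (I _); ring.
  by have := idD idI Ic (Ic2 : I (g * c)); congr (I _); ring.
apply: IH; first exact: ideal_adj.
- by rewrite -colonP.
- by rewrite adjC.
Qed.

(* Mayer-Vietoris: 0 -> R/(A & B) -> R/A + R/B -> R/(A + B) -> 0; the socle of
   the last term is moved by the connecting map. *)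
Lemma wreg_cap M A B fs f u : ideal A -> ideal B -> M f ->
  wreg A (rcons fs f) -> wreg B (rcons fs f) -> wreg (sumI A B) fs ->
  socle M (adjs (sumI A B) fs) u ->
  wreg (capI A B) (rcons fs f) /\
  exists v, socle M (adjs (capI A B) (rcons fs f)) v.
Proof.
move=> iA iB Mf; elim: fs A B iA iB => [|f0 fs IH] A B iA iB /=.
  move=> [nA _] [nB _] _ [nu su]; split.
    by split=> // g [/nA ? /nB ?].
  (* The connecting map: [f * u - a] agrees with [f * u] modulo [A] and with 0 modulo [B]. *)
  have [a Aa Bb] := su _ Mf; exists (f * u - a); split.
    case=> c [Ac Bc]; apply: nu; exists (u - c).
      apply: nA; have := idD iA Ac Aa; congr (A _); ring.
    apply: nB; have := idB iB Bb Bc; congr (B _); ring.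
  move=> g Mg; have [a' Aa' Bb'] := su _ Mg; exists (g * u - a'); split.
    have := idB iA (idMl iA f Aa') (idMl iA g Aa); congr (A _); ring.
  have := idB iB (idMl iB g Bb) (idMl iB f Bb'); congr (B _); ring.
move=> [nA wA] [nB wB] [nS wS] soc.
have eS : sumI (adj A f0) (adj B f0) = adj (sumI A B) f0.
  apply: predP => h; split=> [[a [c Ac] [d Bd]]|[c [a Aa Ba]]].
    exists (c + d), (a - c * f0) => //.
    by move: Bd; congr (B _); ring.
  exists a; first exact: sub_adj.
  by exists c; move: Ba; congr (B _); ring.
have eC : capI (adj A f0) (adj B f0) = adj (capI A B) f0.
  apply: predP => h; split=> [[[c Ac] [d Bd]]|[c [? ?]]]; last by split; exists c.
  (* The two coefficients of [f0] need not agree, but [(c - d) * f0] lies in [A + B], where [f0]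
     cancels; correcting [c] by [a] makes one coefficient serve both ideals. *)
  have [a Aa Ba] : sumI A B (c - d).
    apply: nS; exists (- (h - c * f0)); first exact: idN.
    by move: Bd; congr (B _); ring.
  exists (c - a); split.
    by have := idD iA Ac (idMl iA f0 Aa); congr (A _); ring.
  by have := idB iB Bd (idMl iB f0 Ba); congr (B _); ring.
have [] := IH _ _ (ideal_adj iA f0) (ideal_adj iB f0) wA wB.
- by rewrite eS.
- by rewrite eS.
rewrite eC => wC socC; split=> //; split=> //.
by move=> g [/nA ? /nB ?].
Qed.

End WeaklyRegular.

Lemma ideal_ideal_gen (R : comNzRingType) (G : R -> Prop) : ideal (ideal_gen G).
Proof.
split; first by exists [::]; rewrite ?big_nil.
- move=> _ _ [cg cgG ->] [dg dgG ->]; exists (cg ++ dg); last by rewrite big_cat.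
  by move=> p; rewrite mem_cat => /orP[/cgG|/dgG].
move=> c _ [cg cgG ->]; exists [seq (c * p.1, p.2) | p <- cg].
  by move=> _ /mapP[p /cgG ? ->].
by rewrite big_map mulr_sumr; apply: eq_bigr => p _; rewrite mulrA.
Qed.

Lemma mem_ideal_gen (R : comNzRingType) (G : R -> Prop) g : G g -> ideal_gen G g.
Proof.
move=> Gg; exists [:: (1, g)]; last by rewrite big_seq1 mul1r.
by move=> p; rewrite inE => /eqP->.
Qed.

Lemma ideal_gen_sub (R : comNzRingType) (G I : R -> Prop) :
  ideal I -> (forall g, G g -> I g) -> forall p, ideal_gen G p -> I p.
Proof.
move=> idI GI _ [cg cgG ->]; rewrite big_seq; apply: id_sum => // p /cgG/GI.
exact: idMl.
Qed.

(** * Extension to [R[X]] and comparison of the lengths of regular sequences *)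

Section PolynomialExtension.
Variable R : comNzRingType.
Implicit Types (I : R -> Prop) (f : R) (fs gs : seq R) (p h : {poly R}).

Definition polyP I p := forall i, I p`_i.

Lemma ideal_polyP I : ideal I -> ideal (polyP I).
Proof.
move=> idI; split.
- by move=> i; rewrite coef0; apply: id0.
- by move=> a b Ia Ib i; rewrite coefD; apply: idD.
by move=> c a Ia i; rewrite coefM; apply: id_sum => // j _; apply: idMl.
Qed.

Lemma polyPMX I p f : I 0 -> polyP I (p * 'X + f%:P) <-> polyP I p /\ I f.
Proof.
move=> I0; split=> [Ip|[Ip If] i]; last first.
  by rewrite coefD coefMX coefC; case: i => [|i] /=; rewrite ?add0r ?addr0.
split=> [i|].
  by have := Ip i.+1; rewrite coefD coefMX coefC /= addr0.
by have := Ip 0; rewrite coefD coefMX coefC /= add0r.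
Qed.

(** The coefficientwise witnesses are glued into one polynomial by induction on [p], which avoids a
    choice of witnesses. *)
Lemma polyP_adj I f : ideal I -> polyP (adj I f) = adj (polyP I) f%:P.
Proof.
move=> idI; have I0 := id0 idI; apply: predP => p; split; last first.
  case=> c Ic i; exists c`_i.
  by have := Ic i; rewrite coefB coefMC.
elim/poly_ind: p => [|p a IH].
  by move=> _; apply: sub_adj => i; rewrite coef0.
case/polyPMX=> [|/IH[c Ic] [d Id]]; first exact: sub_adj.
exists (c * 'X + d%:P).
have -> : p * 'X + a%:P - (c * 'X + d%:P) * f%:P
          = (p - c * f%:P) * 'X + (a - d * f)%:P by rewrite polyCB polyCM; ring.
exact/polyPMX.
Qed.

Lemma polyP_adjs I fs : ideal I -> polyP (adjs I fs) = adjs (polyP I) (map polyC fs).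
Proof.
elim: fs I => //= f fs IH I idI; rewrite IH ?polyP_adj //; exact: ideal_adj.
Qed.

Lemma wreg_polyP I fs : ideal I -> wreg I fs -> wreg (polyP I) (map polyC fs).
Proof.
elim: fs I => //= f fs IH I idI [nf wf]; split.
  by move=> p Ip i; apply: nf; have := Ip i; rewrite coefCM.
by rewrite -polyP_adj //; apply: IH => //; apply: ideal_adj.
Qed.

Lemma ideal_sum_but1 I n (F : 'I_n -> R) j : ideal I ->
  (forall i, i != j -> I (F i)) -> I (\sum_i F i) -> I (F j).
Proof.
move=> idI IF; rewrite (bigD1 j) //= addrC; apply: idDr => //.
exact: id_sum.
Qed.

(** In the coefficient of degree [k + i] of [h * g], every term except [h_k * g_i] lies in [I]: by
    [low] when the index at [h] is below [k], by induction on [i] when it is above. *)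
Lemma nzd_lowest I h k : ideal I ->
  (forall i, (i < k)%N -> I h`_i) -> nzd I h`_k -> nzd (polyP I) h.
Proof.
move=> idI low nk g Ihg; elim/ltn_ind => i IH; apply: nk.
have ki : (k < (k + i).+1)%N by rewrite ltnS leq_addr.
have := Ihg (k + i)%N; rewrite coefM.
move/(@ideal_sum_but1 I _ _ (Ordinal ki) idI); rewrite /= addKn; apply=> j.
rewrite -val_eqE /= neq_ltn => /orP[/low jk|kj]; first exact: idMr.
apply: idMl => //; apply: IH.
by rewrite ltn_subLR ?ltn_add2r // -ltnS.
Qed.

Lemma nzd_highest I h k : ideal I ->
  (forall i, (k < i)%N -> I h`_i) -> nzd I h`_k -> nzd (polyP I) h.
Proof.
move=> idI high nk g Ihg.
(* Descending induction on [i], starting beyond the size of [g], where coefficients are 0; [d]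
   bounds the distance to that size. *)
have main d : forall i, (size g <= i + d)%N -> I g`_i.
  elim/ltn_ind: d => d IH i szg; apply: nk.
  have ki : (k < (k + i).+1)%N by rewrite ltnS leq_addr.
  have := Ihg (k + i)%N; rewrite coefM.
  move/(@ideal_sum_but1 I _ _ (Ordinal ki) idI); rewrite /= addKn; apply=> j.
  rewrite -val_eqE /= neq_ltn => /orP[jk|/high jk]; last exact: idMr.
  apply: idMl => //.
  have ij : (i < k + i - j)%N by rewrite ltn_subRL ltn_add2r.
  case: d IH szg => [|d] IH szg.
    rewrite nth_default; first exact: id0.
    by rewrite addn0 in szg; apply: leq_trans szg (ltnW ij).
  by apply: (IH d) => //; apply: leq_trans szg _; rewrite addnS -addSn leq_add2r.
by move=> i; apply: (main (size g)); apply: leq_addl.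
Qed.

End PolynomialExtension.

(* A polynomial whose low coefficients are [gs] and whose high ones are [fs] is a
   nonzerodivisor modulo every prefix of both sequences, so it can replace their
   last elements and then be moved to the front. *)
Lemma wreg_size_le (R : comNzRingType) (M I : R -> Prop) (fs gs : seq R) u :
  ideal I -> M 0 -> (forall f, f \in fs -> M f) -> (forall g, g \in gs -> M g) ->
  wreg I fs -> wreg I gs -> socle M (adjs I fs) u -> (size gs <= size fs)%N.
Proof.
(* The ring is generalized too, since the induction hypothesis is applied over [R[X]]. *)
have [d] := ubnP (size fs); elim: d R M I fs gs u => // d IH R M I fs gs u sz.
move=> idI M0 Mf Mg wf wg soc.
case/lastP: gs Mg wg => // gs g Mg wg.
case/lastP: fs sz Mf wf soc => [|fs f] sz Mf wf soc.
  (* If [fs] is empty, the first entry of the other sequence is regular modulo [I] and kills [u],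
     which would put [u] in [I]. *)
  case: soc => nu su; case: nu; case: gs Mg wg => [|g' gs] Mg /= [nu _]; apply: nu;
    by apply: su; apply: Mg; rewrite inE eqxx.
(* [fs] is reversed so that killing a prefix of it removes top coefficients, just as killing a
   prefix of [gs] removes bottom ones. *)
set h := Poly (rcons gs g ++ rev (rcons fs f)).
have hE i : h`_i = (rcons gs g ++ rev (rcons fs f))`_i by rewrite coef_Poly.
have idP := ideal_polyP idI.
have Mh : polyP M h.
  move=> i; rewrite hE; case: (ltnP i (size (rcons gs g ++ rev (rcons fs f)))) => lti.
    by have := mem_nth 0 lti; rewrite mem_cat mem_rev => /orP[/Mg|/Mf].
  by rewrite nth_default.
have nzf s1 s2 : fs = s1 ++ s2 -> nzd (polyP (adjs I s1)) h.
  move=> e; have [x [s2' e']] : exists x s2', rcons fs f = s1 ++ x :: s2'.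
    by rewrite e rcons_cat; case: s2 {e} => [|x s2]; [exists f, [::]|exists x, (rcons s2 f)].
  (* The entry [x] following the prefix [s1] sits just below the reversed prefix, at this degree. *)
  apply: (@nzd_highest _ _ _ (size (rcons gs g) + size s2')); first exact: ideal_adjs.
    move=> i lti; rewrite hE e' rev_cat rev_cons (cat_rcons x (rev s2')) catA.
    rewrite nth_cat size_cat size_rev ltnNge (ltnW lti) /=.
    case: (i - _)%N (subn_gt0 (size (rcons gs g) + size s2') i) => [|j]; rewrite lti //= => _.
    case: (ltnP j (size s1)) => ltj; last first.
      by rewrite nth_default ?size_rev //; apply: id0; apply: ideal_adjs.
    by apply: mem_adjs => //; rewrite -mem_rev mem_nth ?size_rev.
  rewrite hE e' rev_cat rev_cons (cat_rcons x (rev s2')) catA.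
  rewrite nth_cat size_cat size_rev ltnn subnn /=.
  by move: wf; rewrite e' => /wreg_cat[_ []].
have nzg s1 s2 : gs = s1 ++ s2 -> nzd (polyP (adjs I s1)) h.
  move=> e; have [x [s2' e']] : exists x s2', rcons gs g = s1 ++ x :: s2'.
    by rewrite e rcons_cat; case: s2 {e} => [|x s2]; [exists g, [::]|exists x, (rcons s2 g)].
  apply: (@nzd_lowest _ _ _ (size s1)); first exact: ideal_adjs.
    move=> i lti; rewrite hE e' -catA nth_cat lti.
    by apply: mem_adjs => //; rewrite mem_nth.
  rewrite hE e' -catA nth_cat ltnn subnn /=.
  by move: wg; rewrite e' => /wreg_cat[_ []].
have wreg_h s (ws : wreg I s) : (forall s1 s2, s = s1 ++ s2 -> nzd (polyP (adjs I s1)) h) ->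
    wreg (adj (polyP I) h) (map polyC s).
  move=> nzh; apply: wreg_swap => //; first exact: wreg_polyP.
  move=> s1 s2 e; have /nzh : s = take (size s1) s ++ drop (size s1) s by rewrite cat_take_drop.
  by rewrite polyP_adjs // map_take e take_size_cat.
move/wreg_rcons: wf => [wf nf]; move/wreg_rcons: wg => [wg _].
(* Over [R[X]], the socle modulo [fs] and [f] becomes one modulo [fs] and [h]; moving [h] to the
   front leaves two sequences that are each one shorter. *)
have [v socv] : exists v, socle (polyP M) (adjs (adj (polyP I) h) (map polyC fs)) v.
  rewrite adjs_adjC; apply: (@socle_exchange _ _ _ f%:P h u%:P) => //.
  - exact: ideal_adjs.
  - rewrite -polyP_adjs // => p Ip i; apply: nf; have := Ip i; by rewrite coefCM.
  - by rewrite -polyP_adjs //; apply: (nzf fs [::]); rewrite cats0.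
  rewrite -polyP_adjs // -polyP_adj; last exact: ideal_adjs.
  rewrite -adjs_rcons; case: soc => nu su; split.
    by move/(_ 0); rewrite coefC.
  by move=> p Mp i; rewrite coefMC; apply: su.
rewrite !size_rcons ltnS.
have := IH _ (polyP M) (adj (polyP I) h) (map polyC fs) (map polyC gs) v.
rewrite !size_map; apply.
- by move: sz; rewrite size_rcons.
- exact: ideal_adj.
- by move=> i; rewrite coef0.
- move=> _ /mapP[x xs ->] i; rewrite coefC; case: ifP => // _.
  by apply: Mf; rewrite mem_rcons inE xs orbT.
- move=> _ /mapP[x xs ->] i; rewrite coefC; case: ifP => // _.
  by apply: Mg; rewrite mem_rcons inE xs orbT.
- exact: wreg_h.
- exact: wreg_h.
- exact: socv.
Qed.

(** * Stanley-Reisner ideals and their homogeneous components *)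

Section FaceIdeals.
Variables (K : fieldType) (N : nat).
Implicit Types (p f g : {mpoly K[N]}) (m k : 'X_{1..N}) (D : pred {set 'I_N}).
Implicit Types (F G V Z : {set 'I_N}) (I : {mpoly K[N]} -> Prop).

Definition msup m : {set 'I_N} := [set i | m i != 0%N].

Lemma msupD m k : msup (m + k)%MM = msup m :|: msup k.
Proof. by apply/setP=> i; rewrite !inE mnmDE addn_eq0 negb_and. Qed.

Lemma msupU i : msup U_(i)%MM = [set i].
Proof. by apply/setP=> j; rewrite !inE mnm1E [j == i]eq_sym; case: (i == j). Qed.

Lemma msup_mesym1 F : msup (mesym1 F) = F.
Proof. by apply/setP=> i; rewrite !inE mnmE; case: (i \in F). Qed.

Lemma prodX_mesym1 (F : {set 'I_N}) : \prod_(i in F) 'X_i = 'X_[mesym1 F] :> {mpoly K[N]}.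
Proof.
rewrite mprodXE; congr 'X_[_]; apply/mnmP => i; rewrite mnm_sumE mnmE.
rewrite big_mkcond (bigD1 i) //= big1 ?addn0; first by case: ifP; rewrite ?mnm1E ?eqxx.
by move=> j ji; case: ifP; rewrite // mnm1E (negPf ji).
Qed.

Definition mfilter (P : pred 'X_{1..N}) p := \sum_(m <- msupp p | P m) p@_m *: 'X_[m].

Lemma mcoeff_mfilter P p m : (mfilter P p)@_m = if P m then p@_m else 0.
Proof.
rewrite /mfilter raddf_sum /= -big_filter.
under eq_bigr do rewrite mcoeffZ mcoeffX.
have [ms|ms] := boolP (m \in [seq k <- msupp p | P k]).
  rewrite (bigD1_seq m) //= ?filter_uniq ?msupp_uniq // eqxx mulr1.
  rewrite big1 ?addr0 => [|k /negPf->]; last by rewrite mulr0.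
  by move: ms; rewrite mem_filter => /andP[->].
rewrite big_seq big1 => [|k ks]; last first.
  by rewrite (_ : (k == m) = false) ?mulr0 //; apply/negP=> /eqP e; rewrite -e ks in ms.
move: ms; rewrite mem_filter; case: (P m) => //= ms.
by rewrite (memN_msupp_eq0 ms).
Qed.

Lemma mcoeff_mulX p i m :
  (p * 'X_i)@_m = if m i == 0%N then 0 else p@_(m - U_(i))%MM.
Proof.
have [mi|mi] := eqVneq (m i) 0%N; last first.
  by rewrite -[in LHS](@submK _ U_(i)%MM m) ?lep1mP // addmC mcoeffMX.
apply: memN_msupp_eq0; rewrite (perm_mem (msuppMX _ _)); apply/mapP=> -[k _ e].
by move: mi; rewrite e mnmDE mnm1E eqxx.
Qed.

(* The Stanley-Reisner ideal of [D] when [D] is a simplicial complex. *)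
Definition faceI D p := forall m, D (msup m) -> p@_m = 0.

Definition downset D := forall F G, F \subset G -> D G -> D F.

Lemma eq_faceI D D' : D =1 D' -> faceI D = faceI D'.
Proof. by move=> e; apply: predP => p; split=> Ip m; rewrite (e, esym (e _)); apply: Ip. Qed.

Lemma ideal_faceI D : downset D -> ideal (faceI D).
Proof.
move=> dD; split.
- by move=> m _; rewrite mcoeff0.
- by move=> a b Ia Ib m Dm; rewrite mcoeffD Ia ?Ib ?addr0.
move=> c a Ia m Dm; rewrite mcoeffM big1 // => -[k1 k2] /= /eqP e.
by rewrite Ia ?mulr0 //; apply: dD Dm; have -> := congr1 msup e; rewrite msupD subsetUr.
Qed.

Lemma faceIX D m : ~~ D (msup m) -> faceI D 'X_[m].
Proof.
move=> nD k Dk; rewrite mcoeffX; case: eqP => // e.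
by rewrite e Dk in nD.
Qed.

Lemma faceI_mesym D j : (forall F, #|F| = j -> ~~ D F) -> downset D -> faceI D (mesym N K j).
Proof.
move=> nD dD; rewrite mesymE; apply: id_sum; first exact: ideal_faceI.
by move=> F /eqP cF; apply: faceIX; rewrite msup_mesym1; apply: nD.
Qed.

(** The complex on the right is the star of the vertex [i]; in [adj_faceI] below it is the deletion
    of [i]. *)
Lemma faceI_colon D i :
  (fun p => faceI D ('X_i * p)) = faceI (fun F => D (i |: F)).
Proof.
apply: predP => p; split=> Ip m Dm.
  have := Ip (U_(i) + m)%MM; rewrite mulrC mcoeffMX; apply.
  by rewrite msupD msupU.
rewrite mulrC mcoeff_mulX; case: eqP => // /eqP mi; apply: Ip.
by rewrite -msupU setUC -msupD submK ?lep1mP.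
Qed.

Lemma mfilter_dvdX i p : exists c, mfilter (fun m => m i != 0%N) p = c * 'X_i.
Proof.
exists (\sum_(m <- msupp p | m i != 0%N) p@_m *: 'X_[m - U_(i)]).
rewrite mulr_suml; apply: eq_bigr => m mi.
by rewrite -scalerAl -mpolyXD submK ?lep1mP.
Qed.

Lemma adj_faceI D i : adj (faceI D) 'X_i = faceI (fun F => D F && (i \notin F)).
Proof.
apply: predP => p; split=> [[c Ic] m /andP[Dm im]|Ip].
  have := Ic m Dm; rewrite mcoeffB mcoeff_mulX.
  by move: im; rewrite inE negbK => ->; rewrite subr0.
have [c ec] := mfilter_dvdX i p; exists c => m Dm.
rewrite -ec mcoeffB mcoeff_mfilter; case: ifP; rewrite ?subrr // => /negbT.
by rewrite subr0 => mi; apply: Ip; rewrite Dm inE.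
Qed.

(** Here [D] is a cone with apex [i], so the colon ideal by the variable is no larger than the ideal
    itself. *)
Lemma nzd_faceI D i : (forall F, D F -> D (i |: F)) -> nzd (faceI D) 'X_i.
Proof.
move=> Di g Ig; have : faceI (fun F => D (i |: F)) g by rewrite -faceI_colon.
by move=> Jg m /Di; apply: Jg.
Qed.

Lemma capI_faceI D D' : capI (faceI D) (faceI D') = faceI (fun F => D F || D' F).
Proof.
apply: predP => p; split=> [[I1 I2] m /orP[/I1|/I2]|Ip] //.
by split=> m Dm; apply: Ip; rewrite Dm ?orbT.
Qed.

Lemma sumI_faceI D D' : sumI (faceI D) (faceI D') = faceI (fun F => D F && D' F).
Proof.
apply: predP => p; split=> [[a Ia Ib] m /andP[/Ia a0 /Ib]|Ip].
  by rewrite mcoeffB a0 subr0.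
(* The monomials whose support is not a face of [D] form the first summand; what remains is
   supported on faces of [D]. *)
exists (mfilter (fun m => ~~ D (msup m)) p) => m Dm.
  by rewrite mcoeff_mfilter Dm.
rewrite mcoeffB mcoeff_mfilter; case: ifP => D1; first exact: subrr.
by rewrite Ip ?subr0 // Dm andbT; apply: negbFE.
Qed.

Lemma wreg_total I fs : (forall p, I p) -> wreg I fs.
Proof.
elim: fs I => //= f fs IH I allI; split=> //; apply: IH => p.
by exists 0.
Qed.

Definition graded I := forall d p, I p -> I (pihomog mdeg d p).

Lemma graded_faceI D : graded (faceI D).
Proof. by move=> d p Ip m Dm; rewrite mcoeff_mfilter Ip ?if_same. Qed.

Lemma pihomogM d e p f : f \is e.-homog for mdeg ->
  pihomog mdeg d (p * f) = if (e <= d)%N then pihomog mdeg (d - e) p * f else 0.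
Proof.
move=> hf; have hM (k : nat) : pihomog mdeg k p * f \is (k + e).-homog for mdeg.
  by apply: dhomogM => //; apply: pihomogP.
(* The bound exceeds [d] so that the index [d - e] occurs in the sum even when it lies beyond the
   degree of [p]. *)
rewrite {1}(@pihomog_partitionE _ _ mdeg (maxn (msize p) d.+1) p) ?leq_maxl //.
rewrite mulr_suml raddf_sum /=; case: leqP => ed; last first.
  rewrite big1 // => k _; apply: pihomog_ne0 (hM k); rewrite gtn_eqF //.
  exact: leq_trans ed (leq_addl _ _).
have lt : (d - e < maxn (msize p) d.+1)%N.
  by rewrite leq_max ltnS leq_subr orbT.
rewrite (bigD1 (Ordinal lt)) //= big1 ?addr0 => [|k nk].
  by apply: pihomog_dE; have := hM (d - e)%N; rewrite subnK.
apply: pihomog_ne0 (hM k); apply: contraNneq nk => kd.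
by rewrite -val_eqE /= -(addnK e k) kd.
Qed.

Lemma graded_adj I e f : graded I -> f \is e.-homog for mdeg -> ideal I -> graded (adj I f).
Proof.
move=> gI hf idI d p [c /(gI d)]; rewrite raddfB /= (pihomogM _ _ hf) => Ic.
move: Ic; case: ifP => _ Ic; first by exists (pihomog mdeg (d - e) c).
by exists 0; rewrite mul0r.
Qed.

(* If [f p] is in [I] then [p] is in [I + (x^j)] for every [j], hence in [I], degree
   by degree. *)
Lemma nzd_lift I x f : ideal I -> graded I -> x \is 1.-homog for mdeg ->
  nzd I x -> nzd (adj I x) f -> nzd I f.
Proof.
move=> idI gI hx nx nf p Ip.
have Ixj j q : I (f * q) -> exists c, I (q - c * x ^+ j).
  elim: j q => [|j IH] q Iq; first by exists q; rewrite mulr1 subrr; apply: id0.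
  have [c Ic] := nf _ (sub_adj x Iq).
  have /IH[c' Ic'] : I (f * c).
    apply: nx; have := idB idI Iq (idMl idI f Ic); congr (I _); ring.
  exists c'; have := idD idI Ic (idMl idI x Ic'); congr (I _); rewrite exprS; ring.
rewrite (@pihomog_partitionE _ _ mdeg (msize p) p) //; apply: id_sum => // d _.
(* A multiple of [x ^+ d.+1] has no component of degree [d], so the degree [d] part of [p] itself
   lies in [I]. *)
have [c /(gI d)] := Ixj d.+1 p Ip.
have hxd : x ^+ d.+1 \is d.+1.-homog for mdeg.
  by have := dhomogMn d.+1 hx; rewrite mul1n.
by rewrite raddfB /= (pihomogM _ _ hxd) ltnn subr0.
Qed.

(** Moves [x] from the front to the end of the sequence: [nzd_lift] makes each [f] regular before
    [x], [nzd_swap] keeps [x] regular after [f], and homogeneity keeps the ideals graded. *)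
Lemma wreg_lift I x fs : ideal I -> graded I -> x \is 1.-homog for mdeg -> nzd I x ->
  (forall f, f \in fs -> exists e, f \is e.-homog for mdeg) ->
  wreg (adj I x) fs -> wreg I fs /\ nzd (adjs I fs) x.
Proof.
move=> + + hx; elim: fs I => //= f fs IH I idI gI nx hfs [nf wf].
have [e hf] := hfs f (mem_head _ _).
have nIf := nzd_lift idI gI hx nx nf.
have [|||wI nI] := IH (adj I f) (ideal_adj idI f) (graded_adj gI hf idI).
- exact: nzd_swap.
- by move=> f' f'fs; apply: hfs; rewrite inE f'fs orbT.
- by rewrite adjC.
by split.
Qed.

End FaceIdeals.

Lemma disjointsU (T : finType) (A B C : {set T}) :
  [disjoint A :|: B & C] = [disjoint A & C] && [disjoint B & C].
Proof. by rewrite !disjoints_subset subUset. Qed.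

Lemma disjointsU1 (T : finType) (x : T) (A B : {set T}) :
  [disjoint x |: A & B] = (x \notin B) && [disjoint A & B].
Proof. by rewrite disjointsU disjoints1. Qed.

(** * Elementary symmetric polynomials as weakly regular sequences *)

Section ElementarySymmetric.
Variables (K : fieldType) (N : nat).
Implicit Types (f g p : {mpoly K[N]}) (D : pred {set 'I_N}) (F G V Z : {set 'I_N}).
Implicit Types (I : {mpoly K[N]} -> Prop).

Definition es (k : nat) : seq {mpoly K[N]} := mkseq (fun j => mesym N K j.+1) k.

Lemma nzd_prodX I V : (forall i, i \in V -> nzd I 'X_i) -> nzd I (\prod_(i in V) 'X_i).
Proof.
move=> nI; apply: big_ind => //; first by move=> g; rewrite mul1r.
by move=> x y nx ny g; rewrite -mulrA => /nx/ny.
Qed.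

Lemma nzd_sub I f g : ideal I -> I (f - g) -> nzd I f -> nzd I g.
Proof.
move=> idI Ifg nf p Ip; apply: nf.
by have := idD idI Ip (idMr idI p Ifg); congr (I _); ring.
Qed.

Lemma downset_disjoint Z : downset (fun F => [disjoint F & Z]).
Proof. by move=> F G; apply: disjointWl. Qed.

(* Modulo the variables in [Z] the last symmetric function is the product of the
   remaining variables, each of which may be cut out first by [wreg_lift]. *)
Lemma wreg_es_disjoint Z k : (#|Z| + k <= N)%N ->
  wreg (@faceI K N (fun F => [disjoint F & Z])) (es k).
Proof.
have [c] := ubnP (N - #|Z|)%N; elim: c Z k => // c IH Z k.
rewrite ltnS => cZ lek.
set D := fun F => _; have dD : downset D := @downset_disjoint Z.
have idF := ideal_faceI K dD.
have nX i : i \notin Z -> nzd (@faceI K N D) 'X_i.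
  by move=> iZ; apply: nzd_faceI => F; rewrite /D disjointsU1 iZ.
have lift j i : i \notin Z -> (#|Z| + j < N)%N ->
    wreg (faceI D) (es j) /\ nzd (adjs (faceI D) (es j)) 'X_i.
  move=> iZ ltj; have cZi : #|i |: Z| = #|Z|.+1 by rewrite cardsU1 iZ.
  apply: wreg_lift => //; first exact: graded_faceI.
  - by rewrite dhomogX; rewrite /= mdeg1.
  - exact: nX.
  - by move=> _ /mapP[d _ ->]; exists d.+1; apply: dhomog_mesym.
  rewrite adj_faceI (@eq_faceI _ _ _ (fun F => [disjoint F & i |: Z])); last first.
    by move=> F /=; rewrite /D ![[disjoint F & _]]disjoint_sym disjointsU1 andbC.
  apply: IH; rewrite cZi // subnS.
  by apply: leq_trans cZ; rewrite prednK ?leqnn // subn_gt0; apply: leq_ltn_trans (leq_addr j _) ltj.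
(* With room to spare, one more variable is cut out for the same [k]; otherwise the length equals
   the number of remaining variables and the last entry is treated separately. *)
have [ltk|] := ltnP (#|Z| + k) N.
  have /set0Pn[i] : ~: Z != set0.
    rewrite -card_gt0 -(ltn_add2l #|Z|) cardsC card_ord addn0.
    exact: leq_ltn_trans (leq_addr _ _) ltk.
  by rewrite inE => /lift/(_ ltk)[].
case: k lek => // k lek gek.
have ltk : (#|Z| + k < N)%N by rewrite -addnS.
have eN : (#|Z| + k.+1 = N)%N by apply/eqP; rewrite eqn_leq lek.
rewrite /es mkseqS -/(es k); apply/wreg_rcons; split.
  have /set0Pn[i] : ~: Z != set0.
    by rewrite -card_gt0 -(ltn_add2l #|Z|) cardsC card_ord addn0;
      apply: leq_trans lek; rewrite addnS ltnS leq_addr.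
  by rewrite inE => /lift/(_ ltk)[].
(* Every other square-free monomial of this degree involves a variable of [Z], hence vanishes in the
   quotient. *)
apply: (@nzd_sub _ (\prod_(i in ~: Z) 'X_i)); first exact: ideal_adjs.
  apply: sub_adjs => //; rewrite -opprB; apply: (idN idF).
  have cCZ : #|~: Z| == k.+1.
    by rewrite -(eqn_add2l #|Z|) cardsC card_ord eN.
  rewrite mesymE (bigD1 (~: Z)) //= prodX_mesym1 addrC addrK; apply: id_sum => // F /andP[/eqP cF nF]; apply: faceIX.
  rewrite msup_mesym1; apply: contraNN nF; rewrite /D disjoints_subset => sF.
  by rewrite eqEcard sF (eqP cCZ) cF leqnn.
by apply: nzd_prodX => i; rewrite inE => /lift/(_ ltk)[].
Qed.

Lemma card_setIU1 V F i : i \in V -> #|(i |: F) :&: V| = #|F :&: (V :\ i)|.+1.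
Proof.
move=> iV; rewrite (cardsD1 i) !inE eqxx iV add1n; congr _.+1.
by apply: eq_card => j; rewrite !inE; case: (j == i); rewrite //= ?andbF.
Qed.

Lemma downset_card V a : downset (fun F => #|F :&: V| < a)%N.
Proof. by move=> F G sFG; apply: leq_ltn_trans; apply/subset_leq_card/setSI. Qed.

Lemma downset_and D D' : downset D -> downset D' -> downset (fun F => D F && D' F).
Proof. by move=> dD dD' F G sFG /andP[/(dD _ _ sFG)-> /(dD' _ _ sFG)->]. Qed.

Lemma downset_or D D' : downset D -> downset D' -> downset (fun F => D F || D' F).
Proof.
by move=> dD dD' F G sFG /orP[/(dD _ _ sFG)->|/(dD' _ _ sFG)->]; rewrite ?orbT.
Qed.

(* Deletion and contraction of the elements of [V] in turn reduce the bound on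
   [#|F :&: V|] to the avoidance of subsets of [V]. *)
Lemma wreg_skeleton V a D fs : downset D ->
  (forall F G, F :\: V = G :\: V -> D F = D G) -> (0 < a <= #|V|.+1)%N ->
  (forall Z, Z \subset V -> (#|Z| + a = #|V|.+1)%N ->
     wreg (@faceI K N (fun F => D F && [disjoint F & Z])) fs) ->
  wreg (@faceI K N (fun F => D F && (#|F :&: V| < a)%N)) fs.
Proof.
have [c] := ubnP #|V|; elim: c V a D => // c IH V a D cV dD indD /andP[a0].
rewrite leq_eqVlt => /predU1P[ea|lta] base.
  rewrite (@eq_faceI _ _ _ (fun F => D F && [disjoint F & set0])).
    by apply: base; rewrite ?sub0set ?cards0.
  move=> F; rewrite ea ltnS subset_leq_card ?subsetIr //.
  by rewrite disjoint_sym disjoints_subset sub0set.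
have /card_gt0P[i iV] : (0 < #|V|)%N by apply: leq_trans a0 _; rewrite -ltnS.
have cVi := cardsD1 i V; rewrite iV add1n in cVi.
have subV Z : Z \subset V :\ i -> Z \subset V by move/subset_trans; apply; apply: subsetDl.
have indDi F G : F :\: (V :\ i) = G :\: (V :\ i) -> D F = D G /\ (i \in F) = (i \in G).
  move=> /setP e; split; last by have := e i; rewrite !inE eqxx.
  apply: indD; apply/setP=> j; have := e j; rewrite !inE.
  by case: (j == i) (eqVneq j i) => // -[->|] //; rewrite iV.
apply: (@wreg_colon _ _ 'X_i).
- by apply: ideal_faceI; apply: downset_and => //; apply: downset_card.
- rewrite faceI_colon.
  rewrite (@eq_faceI _ _ _ (fun F => D F && (#|F :&: (V :\ i)| < a.-1)%N)); last first.
    move=> F /=; rewrite card_setIU1 // -[in LHS](prednK a0) ltnS; congr (_ && _); apply: indD.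
    by apply/setP=> j; rewrite !inE; case: eqVneq => // ->; rewrite iV.
  have [a1|a1] := leqP a 1.
    apply: wreg_total => p m; move: a1; rewrite -ltnS -(prednK a0) !ltnS leqn0 => /eqP->.
    by rewrite ltn0 andbF.
  apply: IH => //.
  + by rewrite -ltnS -cVi.
  + by move=> F G /indDi[].
  + by lia.
  move=> Z /subV sZ cZ; apply: base => //; lia.
rewrite adj_faceI.
(* Avoidance of [i] is absorbed into the condition [D]; at the end [i] joins the avoided set, which
   restores the cardinality relation. *)
rewrite (@eq_faceI _ _ _ (fun F => (D F && (i \notin F)) && (#|F :&: (V :\ i)| < a)%N)); last first.
  move=> F; rewrite /= -!andbA; congr (_ && _); rewrite andbC.
  case: (boolP (i \in F)) => //= iF; congr (_ < a)%N; apply: eq_card => j.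
  by rewrite !inE; case: eqVneq => // ->; rewrite (negPf iF).
apply: IH.
- by rewrite -ltnS -cVi.
- by apply: downset_and => // F G sFG; apply: contra; apply: (subsetP sFG).
- by move=> F G /indDi[-> ->].
- lia.
move=> Z sZ cZ.
have iZ : i \notin Z by apply/negP => /(subsetP sZ); rewrite !inE eqxx.
rewrite (@eq_faceI _ _ _ (fun F => D F && [disjoint F & i |: Z])).
  by apply: base; rewrite ?subUset ?sub1set ?iV ?subV // cardsU1 iZ; lia.
by move=> F; rewrite /= -andbA ![[disjoint F & _]]disjoint_sym disjointsU1.
Qed.

(** [wreg_skeleton] is applied to [Y] and then to [X]; the avoided sets have [#|Y| + 1 - b] and
    [#|X| + 1 - a] elements, which leaves [a + b - 2] variables for [wreg_es_disjoint]. *)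
Lemma wreg_join (X Y : {set 'I_N}) a b k : [disjoint X & Y] ->
  (0 < a <= #|X|.+1)%N -> (0 < b <= #|Y|.+1)%N -> (#|X| + #|Y| = N)%N -> (k + 2 <= a + b)%N ->
  wreg (@faceI K N (fun F => (#|F :&: X| < a) && (#|F :&: Y| < b))%N) (es k).
Proof.
move=> dXY ha hb cN lek.
apply: wreg_skeleton => //; first exact: downset_card.
  move=> F G /setP e; congr (_ < a)%N; apply: eq_card => j; have := e j; rewrite !inE.
  case: (boolP (j \in X)) => [jX|]; last by rewrite !andbF.
  by rewrite (disjointFr dXY jX) /= !andbT.
move=> Z' sZ' cZ'.
rewrite (@eq_faceI _ _ _ (fun F => [disjoint F & Z'] && (#|F :&: X| < a)%N)); last first.
  by move=> F /=; rewrite andbC.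
apply: wreg_skeleton => //; first exact: downset_disjoint.
  move=> F G /setP e; rewrite -!setI_eq0; congr (_ == _); apply/setP=> j; have := e j.
  rewrite !inE; case: (boolP (j \in Z')) => [jZ|]; last by rewrite !andbF.
  by rewrite (disjointFl dXY (subsetP sZ' _ jZ)) /= !andbT.
move=> Z sZ cZ.
rewrite (@eq_faceI _ _ _ (fun F => [disjoint F & Z' :|: Z])); last first.
  by move=> F; rewrite ![[disjoint F & _]]disjoint_sym disjointsU.
apply: wreg_es_disjoint.
apply: leq_trans (_ : #|Z'| + #|Z| + k <= N)%N; first by rewrite leq_add2r leq_card_setU.
lia.
Qed.

End ElementarySymmetric.

(** * Socles of Artinian quotients *)

Section Socle.
Variables (K : fieldType) (N : nat).
Implicit Types (L : {mpoly K[N]} -> Prop) (u f : {mpoly K[N]}).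

Definition maxI : {mpoly K[N]} -> Prop := ideal_gen (fun f => exists i : 'I_N, f = 'X_i).

Lemma maxI_mesym j : (0 < j)%N -> maxI (mesym N K j).
Proof.
move=> j0; have idM := @ideal_ideal_gen _ (fun f => exists i : 'I_N, f = 'X_i).
apply: (id_sum idM) => F /eqP cF; have /card_gt0P[i iF] : (0 < #|F|)%N by rewrite cF.
by rewrite (big_setD1 i) //=; apply: (idMr idM); apply: mem_ideal_gen; exists i.
Qed.

(** Starting from 1, multiply by the largest power of each variable in turn that stays outside [L];
    being killed by the earlier variables persists under multiplication. *)
Lemma nilpotent_socle L n : ideal L -> ~ L 1 -> (forall i, L ('X_i ^+ n)) ->
  exists u, socle maxI L u.
Proof.
move=> idL L1 Lx.
have step i u : ~ L u -> exists2 c, ~ L (c * u) & L ('X_i * (c * u)).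
  have : L ('X_i ^+ n * u) by apply: idMr.
  elim: n u {Lx} => [|n IH] u; first by rewrite mul1r.
  rewrite exprSr -mulrA => Lnu nLu.
  have [Lxu|nLxu] := classic (L ('X_i * u)); first by exists 1; rewrite mul1r.
  by have [c nc Lc] := IH _ Lnu nLxu; exists (c * 'X_i); rewrite -mulrA.
have [u nLu Lu] : exists2 u, ~ L u & forall i, i \in enum 'I_N -> L ('X_i * u).
  elim: (enum _) => [|i s [u nLu Lu]]; first by exists 1.
  have [c nLc Lc] := step i u nLu; exists (c * u) => // j.
  by rewrite inE => /predU1P[->|/Lu] //; rewrite mulrCA; apply: idMl.
exists u; split=> //; apply: ideal_gen_sub => [|_ [i ->]]; last by apply: Lu; rewrite mem_enum.
split=> [|a b La Lb|c a La]; first by rewrite mul0r; apply: id0.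
- by rewrite mulrDl; apply: idD.
by rewrite -mulrA; apply: idMl.
Qed.

(** Each variable is a root of the monic polynomial whose roots are all the variables, and its lower
    coefficients are, up to sign, elementary symmetric polynomials in [L]. *)
Lemma X_nilpotent L : ideal L -> (forall j, (0 < j <= N)%N -> L (mesym N K j)) ->
  forall i, L ('X_i ^+ N).
Proof.
move=> idL Le i.
pose cs := [tuple 'X_i | i < N] : N.-tuple {mpoly K[N]}.
pose P := \prod_(c <- cs) ('X - c%:P).
(* [mroots_coeff] yields symmetric polynomials evaluated at the roots; here the roots are the
   variables themselves. *)
have ev k : (mesym N {mpoly K[N]} k).@[tnth cs] = mesym N K k.
  rewrite /mesym raddf_sum; apply: eq_bigr => h _.
  rewrite /= rmorph_prod; apply: eq_bigr => j _.
  by rewrite /= mevalXU tnth_mktuple.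
have szP : size P = N.+1 by rewrite size_prod_XsubC size_tuple.
have PX : P.['X_i] = 0.
  apply/rootP; rewrite root_prod_XsubC; apply/tnthP; exists i.
  by rewrite tnth_mktuple.
have coefP (j : 'I_N.+1) : P`_(N - j) = (-1) ^+ j * mesym N K j.
  by rewrite /P mroots_coeff ev.
move: PX; rewrite horner_coef szP big_ord_recr /=.
have -> : P`_N = 1.
  by have := coefP ord0; rewrite subn0 mesym0E expr0 mulr1.
rewrite mul1r => e; apply: (idDr idL (a := \sum_(j < N) P`_j * 'X_i ^+ j)).
  apply: id_sum => // j _; apply: idMr => //.
  have lt : (N - j < N.+1)%N by rewrite ltnS leq_subr.
  have := coefP (Ordinal lt); rewrite /= subKn 1?ltnW // => ->.
  by apply: idMl => //; apply: Le; rewrite subn_gt0 ltn_ord leq_subr.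
by rewrite e; apply: id0.
Qed.

(** Vanishing constant terms keep 1 out of the ideal. *)
Lemma adjs_coef0 I (fs : seq {mpoly K[N]}) : (forall p, I p -> p@_0%MM = 0) ->
  (forall f, f \in fs -> f@_0%MM = 0) -> forall p, adjs I fs p -> p@_0%MM = 0.
Proof.
elim: fs I => //= f fs IH I I0 f0; apply: IH => [p [c /I0]|g gfs]; last first.
  by apply: f0; rewrite inE gfs orbT.
by rewrite mcoeffB (mcoeff0_is_multiplicative _ _).1 (f0 f) ?mem_head // mulr0 subr0.
Qed.

Lemma mcoeff0_mesym j : (0 < j)%N -> (mesym N K j)@_0%MM = 0.
Proof.
move=> j0; apply: (dhomog_nemf_coeff (mf := mdeg) (dhomog_mesym _ _ j)).
by rewrite mf0 eq_sym -lt0n.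
Qed.

Lemma socle_join (X Y : {set 'I_N}) a b : X :|: Y = setT -> [disjoint X & Y] ->
  (0 < a)%N -> (0 < b)%N ->
  exists u, socle maxI
    (adjs (@faceI K N (fun F => (#|F :&: X| < a) && (#|F :&: Y| < b))%N) (es K N (a + b - 2))) u.
Proof.
move=> eXY dXY a0 b0; set D := (X in faceI X).
have dD : downset D by apply: downset_and; apply: downset_card.
have idL := ideal_adjs (es K N (a + b - 2)) (ideal_faceI K dD).
apply: (@nilpotent_socle _ N) => //.
  move=> L1; suff /eqP : (1 : {mpoly K[N]})@_0%MM = 0 by rewrite mcoeff1 eqxx oner_eq0.
  apply: adjs_coef0 L1 => [p Ip|_ /mapP[j _ ->]]; last exact: mcoeff0_mesym.
  by apply: Ip; rewrite /D (_ : msup _ = set0) ?set0I ?cards0 ?a0 //; apply/setP=> i; rewrite !inE mnm0E.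
apply: X_nilpotent => // j /andP[j0 _].
have [lej|ltj] := leqP j (a + b - 2).
  apply: mem_adjs; first exact: ideal_faceI.
  by apply/mapP; exists j.-1; rewrite ?prednK // mem_iota add0n; lia.
(* A set with more than [(a - 1) + (b - 1)] elements has at least [a] in [X] or at least [b] in [Y],
   so the higher symmetric polynomials are already in the face ideal. *)
apply: sub_adjs; first exact: ideal_faceI.
apply: faceI_mesym => // F cF; rewrite /D.
have := cardsID X F; have -> : F :\: X = F :&: Y.
  apply/setP=> i; rewrite !inE; have := in_setT i; rewrite -eXY inE.
  by case: (boolP (i \in X)) => /= [iX _|_ ->]; rewrite ?andbT // (disjointFr dXY iX) andbF.
by rewrite cF -/D; lia.
Qed.

End Socle.

(** * Depth from a weakly regular sequence and a socle *)

Section Depth.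
Variable R : comNzRingType.
Implicit Types (M I J : R -> Prop) (f : R) (fs : seq R).

Lemma ideal_addE I J : ideal_add I J = sumI I J.
Proof.
apply: predP => h; split=> [[a [b [Ia Jb ->]]]|[a Ia Jb]].
  by exists a; rewrite // addrC addKr.
by exists a, (h - a); rewrite [a + _]addrC subrK.
Qed.

Lemma ideal_add_gen1 I f : ideal_add I (ideal_gen (fun h => h = f)) = adj I f.
Proof.
apply: predP => h; split=> [[a [_ [Ia [cg cgf ->] ->]]]|[c Ic]]; last first.
  exists (h - c * f), (c * f); rewrite subrK; split=> //.
  by exists [:: (c, f)]; [move=> p; rewrite inE => /eqP->|rewrite big_seq1].
exists (\sum_(p <- cg) p.1); rewrite mulr_suml big_seq [X in _ - X]big_seq.
by rewrite (eq_bigr (fun p => p.1 * f)) ?addrK // => p /cgf->.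
Qed.

Lemma regular_on_quotE I fs : regular_on_quot I fs <-> wreg I fs /\ ~ adjs I fs 1.
Proof.
elim: fs I => [|f fs IH] I /=; first by split=> // -[].
by rewrite ideal_add_gen1 IH; split=> [[? []]|[[]]].
Qed.

(** The socle serves twice: it shows that the final quotient is nonzero, and through [wreg_size_le]
    it bounds every other regular sequence. *)
Lemma depth_quot_socle M I fs u : ideal I -> M 0 -> (forall f, f \in fs -> M f) ->
  wreg I fs -> socle M (adjs I fs) u -> depth_quot M I (size fs).
Proof.
move=> idI M0 Mfs wfs soc; split=> [|gs Mgs /regular_on_quotE[wgs _]]; last first.
  exact: wreg_size_le wfs wgs soc.
exists fs; split=> //; apply/regular_on_quotE; split=> // L1.
case: soc => nLu _; apply: nLu; rewrite -[u]mul1r.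
by apply: idMr => //; apply: ideal_adjs.
Qed.

End Depth.

(** * Depth of face ideals, and the ideals of the theorem as face ideals *)

Section FaceDepth.
Variables (K : fieldType) (N : nat).
Implicit Types (D : pred {set 'I_N}) (d k : nat).

(** Depth witnessed by one fixed sequence for all complexes, since [wreg_cap] needs the same
    sequence for both ideals and for their sum. *)
Definition face_depth D d :=
  wreg (@faceI K N D) (es K N d) /\
  exists u, socle (@maxI K N) (adjs (@faceI K N D) (es K N d)) u.

Lemma face_depthP D d : downset D -> face_depth D d ->
  depth_quot (@maxI K N) (@faceI K N D) d.
Proof.
move=> dD [wD [u soc]].
rewrite -[d](size_mkseq (fun j => mesym N K j.+1)).
apply: depth_quot_socle wD soc; first exact: ideal_faceI.
  by apply: id0; apply: ideal_ideal_gen.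
by move=> _ /mapP[j _ ->]; apply: maxI_mesym.
Qed.

Lemma eq_face_depth D D' d : D =1 D' -> face_depth D d -> face_depth D' d.
Proof. by move=> e; rewrite /face_depth (eq_faceI K e). Qed.

Lemma wreg_es_le (I : {mpoly K[N]} -> Prop) d k : (k <= d)%N -> wreg I (es K N d) -> wreg I (es K N k).
Proof.
move/subnKC <-; rewrite /es /mkseq iotaD map_cat => /wreg_cat[]//.
Qed.

(** The step [wreg_cap] with [mesym N K d.+1] as last element: a union of complexes corresponds to
    the intersection of their ideals, an intersection to the sum. *)
Lemma face_depth_or D D' d : downset D -> downset D' ->
  wreg (@faceI K N D) (es K N d.+1) -> wreg (@faceI K N D') (es K N d.+1) ->
  face_depth (fun F => D F && D' F) d -> face_depth (fun F => D F || D' F) d.+1.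
Proof.
move=> dD dD' wD wD' [wI [u soc]].
rewrite /face_depth -capI_faceI /es mkseqS.
rewrite -sumI_faceI in wI soc.
rewrite /es mkseqS in wD wD'.
apply: wreg_cap wD wD' wI soc; first exact: ideal_faceI.
  exact: ideal_faceI.
exact: maxI_mesym.
Qed.

Lemma face_depth_join (X Y : {set 'I_N}) a b : X :|: Y = setT -> [disjoint X & Y] ->
  (0 < a <= #|X|.+1)%N -> (0 < b <= #|Y|.+1)%N ->
  face_depth (fun F => (#|F :&: X| < a) && (#|F :&: Y| < b))%N (a + b - 2).
Proof.
move=> eXY dXY ha hb; split.
  apply: wreg_join => //; last by lia.
  have [_] := leq_card_setU X Y; rewrite dXY => /eqP<-.
  by rewrite eXY cardsT card_ord.
by case/andP: ha hb => a0 _ /andP[b0 _]; apply: socle_join.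
Qed.

Lemma ideal_mono (I : {mpoly K[N]} -> Prop) (p : {mpoly K[N]}) : ideal I ->
  (forall m, p@_m != 0 -> I 'X_[m]) -> I p.
Proof.
move=> idI Im; rewrite [p]mpolyE big_seq; apply: id_sum => // m.
by rewrite mcoeff_msupp -mul_mpolyC => /Im; apply: idMl.
Qed.

Lemma faceI_msupp D p m : @faceI K N D p -> p@_m != 0 -> ~~ D (msup m).
Proof. by move=> Ip; apply: contra_neqN => /Ip. Qed.

Lemma sqfree_faceI l (f : 'I_l -> 'I_N) a : injective f ->
  ideal_gen (fun p => exists2 A : {set 'I_l}, #|A| = a & p = \prod_(i in A) 'X_(f i))
  = @faceI K N (fun F => #|F :&: f @: setT| < a)%N.
Proof.
move=> injf; have prodE (A : {set 'I_l}) :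
    \prod_(i in A) 'X_(f i) = 'X_[mesym1 (f @: A)] :> {mpoly K[N]}.
  by rewrite -prodX_mesym1 big_imset //= => i j _ _; apply: injf.
apply: predP => p; split.
  apply: ideal_gen_sub; first by apply: ideal_faceI; apply: downset_card.
  move=> _ [A cA ->]; rewrite prodE; apply: faceIX.
  by rewrite msup_mesym1 (setIidPl _) ?imsetS ?subsetT // card_imset // cA ltnn.
move=> Ip; apply: ideal_mono; first exact: ideal_ideal_gen.
move=> m /(faceI_msupp Ip); rewrite -leqNgt.
have -> : msup m :&: f @: setT = f @: (f @^-1: msup m).
  apply/setP=> j; rewrite inE; apply/andP/imsetP=> [[jm /imsetP[i _ e]]|[i]].
    by exists i; rewrite // inE -e.
  by rewrite inE => im ->; rewrite im imset_f.
rewrite card_imset // => lea.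
(* Any [a] of the block variables dividing the monomial give a generator that divides it. *)
pose A := [set x in take a (enum (f @^-1: msup m))].
have cA : #|A| = a.
  have /card_uniqP cu : uniq (take a (enum (f @^-1: msup m))) by rewrite take_uniq ?enum_uniq.
  by rewrite cardsE cu size_takel // -cardE.
have Am : (mesym1 (f @: A) <= m)%MM.
  apply/mnm_lepP => j; rewrite mnmE; case: imsetP => // -[i iA ->].
  rewrite lt0n; move: iA; rewrite inE => /mem_take.
  by rewrite mem_enum !inE.
rewrite -(submK Am) mpolyXD; apply: idMl; first exact: ideal_ideal_gen.
by apply: mem_ideal_gen; exists A; rewrite ?prodE.
Qed.

(** Product and intersection coincide because the two ideals involve disjoint sets of variables: a
    monomial in both splits into a factor from each. *)
Lemma ideal_mul_faceI (X Y : {set 'I_N}) a b : [disjoint X & Y] ->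
  ideal_mul (@faceI K N (fun F => #|F :&: X| < a)%N) (@faceI K N (fun F => #|F :&: Y| < b)%N)
  = @faceI K N (fun F => (#|F :&: X| < a) || (#|F :&: Y| < b))%N.
Proof.
move=> dXY; have dX := @downset_card _ X a; have dY := @downset_card _ Y b.
apply: predP => p; split.
  apply: ideal_gen_sub; first by apply: ideal_faceI; apply: downset_or.
  move=> _ [f [g [If Ig ->]]]; rewrite -capI_faceI; split.
    exact: idMr (ideal_faceI K dX) _ _ If.
  exact: idMl (ideal_faceI K dY) _ _ Ig.
move=> Ip; apply: ideal_mono; first exact: ideal_ideal_gen.
move=> m /(faceI_msupp Ip); rewrite negb_or => /andP[nX nY].
pose mX := [multinom if i \in X then m i else 0%N | i < N].
(* Variables outside both blocks go into this factor. *)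
pose mY := [multinom if i \in X then 0%N else m i | i < N].
have -> : m = (mX + mY)%MM.
  by apply/mnmP=> i; rewrite mnmDE !mnmE; case: ifP; rewrite ?addn0.
rewrite mpolyXD; apply: mem_ideal_gen; exists 'X_[mX], 'X_[mY]; split=> //; apply: faceIX.
  have -> // : msup mX :&: X = msup m :&: X.
  by apply/setP=> i; rewrite !inE mnmE; case: (i \in X); rewrite ?andbF.
have -> // : msup mY :&: Y = msup m :&: Y.
apply/setP=> i; rewrite !inE mnmE; case: (boolP (i \in X)) => // iX.
by rewrite (disjointFr dXY iX) !andbF.
Qed.

End FaceDepth.


(** * Mayer-Vietoris for two complementary blocks of variables *)

Section TwoBlocks.
Variables (K : fieldType) (N : nat) (X Y : {set 'I_N}).
Hypotheses (eXY : X :|: Y = setT) (dXY : [disjoint X & Y]).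
Local Open Scope nat_scope.

(** The ideal is the intersection of [I_q] and [I_s + J_r], whose sum [I_q + J_r] has depth
    [q + r - 2]. *)
Lemma face_depth_or_join q s r : 0 < q < s -> s <= #|X| -> 0 < r <= #|Y| ->
  face_depth K (fun F => (#|F :&: X| < q) || (#|F :&: X| < s) && (#|F :&: Y| < r)) (q + r - 1).
Proof.
move=> hq hs hr.
have -> : q + r - 1 = (q + r - 2).+1 by lia.
apply: face_depth_or.
- exact: downset_card.
- by apply: downset_and; apply: downset_card.
(* [I_q] alone is a join with the vacuous bound [#|Y|.+1] on the other block. *)
- rewrite (@eq_faceI _ _ _ (fun F => (#|F :&: X| < q) && (#|F :&: Y| < #|Y|.+1))).
    apply: (@wreg_es_le _ _ _ (q + #|Y|.+1 - 2)); first lia.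
    by apply: (face_depth_join _ eXY dXY _ _).1; lia.
  by move=> F; rewrite /= [_ < #|Y|.+1]subset_leq_card ?subsetIr ?andbT.
- apply: (@wreg_es_le _ _ _ (s + r - 2)); first lia.
  by apply: (face_depth_join _ eXY dXY _ _).1; lia.
apply: eq_face_depth (face_depth_join _ eXY dXY _ _); [|lia|lia].
move=> F /=; case: ltnP => //= ltq.
by rewrite (leq_trans ltq) //; lia.
Qed.

(** Splits off [I_q]: its sum with the intersection of [J_t] and [I_s + J_r] is again [I_q + J_r].
    The assumption [q + r <= s + t] makes the given regular sequence on the second ideal long
    enough. *)
Lemma face_depth_or_and q s r t : 0 < q < s -> s <= #|X| -> 0 < t < r -> r <= #|Y| ->
  q + r <= s + t ->
  wreg (@faceI K N (fun F =>
    (#|F :&: Y| < t) || (#|F :&: Y| < r) && (#|F :&: X| < s))) (es K N (t + s - 1)) ->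
  face_depth K (fun F => (#|F :&: X| < q) ||
    ((#|F :&: Y| < t) || (#|F :&: Y| < r) && (#|F :&: X| < s))) (q + r - 1).
Proof.
move=> hq hs ht hr le w.
have -> : q + r - 1 = (q + r - 2).+1 by lia.
apply: face_depth_or.
- exact: downset_card.
- by apply: downset_or; [|apply: downset_and]; apply: downset_card.
- rewrite (@eq_faceI _ _ _ (fun F => (#|F :&: X| < q) && (#|F :&: Y| < #|Y|.+1))).
    apply: (@wreg_es_le _ _ _ (q + #|Y|.+1 - 2)); first lia.
    by apply: (face_depth_join _ eXY dXY _ _).1; lia.
  by move=> F; rewrite /= [_ < #|Y|.+1]subset_leq_card ?subsetIr ?andbT.
- by apply: wreg_es_le w; lia.
apply: eq_face_depth (face_depth_join _ eXY dXY _ _); [|lia|lia].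
by move=> F /=; lia.
Qed.

End TwoBlocks.

(* The three depth formulas *)
Local Close Scope ring_scope.
Theorem theorem3p7 (K : fieldType) (n m q s t r : nat)
  (hq : 1 <= q) (hqs : q < s) (hsn : s <= n)
  (ht : 1 <= t) (htr : t < r) (hrm : r <= m) :
  let I := sqfree_x K n m in
  let J := sqfree_y K n m in
  [/\ depth_S_mod (ideal_add (I s) (J r)) (s + r - 2),
      depth_S_mod (ideal_add (ideal_mul (I q) (J r)) (I s)) (q + r - 1) &
      depth_S_mod (ideal_add (ideal_mul (I q) (J r)) (ideal_mul (I s) (J t)))
        (minn (q + r) (s + t) - 1)].
Proof.
move=> I J.
pose X : {set 'I_(n + m)} := @lshift n m @: setT.
pose Y : {set 'I_(n + m)} := @rshift n m @: setT.
have cX : #|X| = n by rewrite card_imset ?cardsT ?card_ord //; apply: lshift_inj.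
have cY : #|Y| = m by rewrite card_imset ?cardsT ?card_ord //; apply: rshift_inj.
have eXY : X :|: Y = setT.
  apply/setP=> i; rewrite inE [RHS]inE; case: (split_ordP i) => j ->.
    by rewrite imset_f.
  by rewrite [_ \in Y]imset_f ?orbT.
have dXY : [disjoint X & Y].
  rewrite -setI_eq0; apply/eqP/setP=> i; rewrite !inE; apply/negP => /andP[].
  by move=> /imsetP[j _ ->] /imsetP[k _] /eqP; rewrite eq_lrshift.
have eYX : Y :|: X = setT by rewrite setUC.
have dYX : [disjoint Y & X] by rewrite disjoint_sym.
have IE a : I a = faceI (fun F => #|F :&: X| < a) by apply: sqfree_faceI; apply: lshift_inj.
have JE a : J a = faceI (fun F => #|F :&: Y| < a) by apply: sqfree_faceI; apply: rshift_inj.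
have dX := @downset_card _ X; have dY := @downset_card _ Y.
have q0 : 0 < q < s by rewrite hq.
have t0 : 0 < t < r by rewrite ht.
rewrite !ideal_addE !IE !JE !ideal_mul_faceI // !sumI_faceI.
split; apply: face_depthP.
- exact: downset_and.
- by apply: face_depth_join; rewrite // ?cX ?cY; lia.
- by apply: downset_and => //; apply: downset_or.
- have r0 : 0 < r <= #|Y| by rewrite cY; lia.
  apply: eq_face_depth (face_depth_or_join _ eXY dXY q0 _ r0); last by rewrite cX.
  (* The distributive law for sets of faces, where [q < s] makes the bound by [q] imply the bound by
     [s]. *)
  by move=> F /=; lia.
- by apply: downset_and; apply: downset_or.
have s0 : 0 < s <= #|X| by rewrite cX; lia.
have r0 : 0 < r <= #|Y| by rewrite cY; lia.
have sX : s <= #|X| by rewrite cX.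
have rY : r <= #|Y| by rewrite cY.
(* The ideal attaining the minimum is split off first: [I_q] here, and [J_t] in the other case, with
   the two blocks exchanged. The remaining intersection is covered by [face_depth_or_join]. *)
case: (leqP (q + r) (s + t)) => [le|/ltnW le].
  apply: eq_face_depth (face_depth_or_and eXY dXY q0 sX t0 rY le _).
    by move=> F /=; lia.
  exact: (face_depth_or_join _ eYX dYX t0 rY s0).1.
rewrite [s + t]addnC in le *.
apply: eq_face_depth (face_depth_or_and eYX dYX t0 rY q0 sX _ _).
- by move=> F /=; lia.
- by rewrite [r + q]addnC.
exact: (face_depth_or_join _ eXY dXY q0 sX r0).1.
Qed.
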